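(* Let $G$ be a connected graph. Then $G$ is $6$-periodic (that is, $G$ induces a $6$-periodic Grover walk) if and only if $G$ is isomorphic to a Dutch windmill graph $D_3^{(t)}$ for some integer $t\geq 2$ or to a uniform theta graph $\Theta(t,2)$ for some integer $t\geq 1$.
   Context: Graphs are simple and finite. For a graph $G=(V,E)$, let $d_x$ be the degree of a vertex $x$ and let $\mathcal{A}=\{(x,y),(y,x) \mid \{x,y\}\in E\}$ be the set of symmetric arcs. For an arc $a=(x,y)$ write $o(a)=x$ (origin), $t(a)=y$ (terminus) and $a^{-1}=(y,x)$. The time evolution matrix of the Grover walk on $G$ is $U=U(G)\in\mathbb{C}^{\mathcal{A}\times\mathcal{A}}$ with entries \[ U_{a,b} = \frac{2}{d_{t(b)}}\,\delta_{o(a),t(b)} - \delta_{a,b^{-1}}, \] where $\delta$ is the Kronecker delta. For a positive integer $\tau$, $G$ is called $\tau$-periodic if $\tau$ is the smallest positive integer with $U(G)^\tau = I$. The Dutch windmill graph $D_3^{(t)}$ is obtained from $t$ disjoint copies of the triangle $C_3$ by identifying one vertex from each copy into a single common vertex. The uniform theta graph $\Theta(t,2)$ is obtained from $t$ pairwise vertex-disjoint path graphs on $2$ vertices by adding two new vertices and, for each path, joining one endpoint to the first new vertex and the other endpoint to the second new vertex. *)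

(* Defs.v *)
From mathcomp Require Import all_boot all_order all_algebra.
From mathcomp Require Import complex reals.

Set Implicit Arguments.
Unset Strict Implicit.
Unset Printing Implicit Defensive.

Import Order.TTheory GRing.Theory Num.Theory.

Local Open Scope ring_scope.

Record sgraph := SGraph {
  vertex :> finType;
  edge : rel vertex;
  edge_sym : symmetric edge;
  edge_irrefl : irreflexive edge
}.

Definition connected (G : sgraph) : Prop :=
  forall x y : G, connect (@edge G) x y.

Definition isomorphic (G H : sgraph) : Prop :=
  exists2 f : G -> H, bijective f & forall x y, edge (f x) (f y) = edge x y.

Definition degree (G : sgraph) (x : G) : nat := #|[set y | edge x y]|.

Definition arc (G : sgraph) : predArgType := {p : G * G | edge p.1 p.2}.

Definition origin (G : sgraph) (a : arc G) : G := (val a).1.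
Definition terminus (G : sgraph) (a : arc G) : G := (val a).2.

Lemma arc_inv_subproof (G : sgraph) (a : arc G) :
  edge (terminus a, origin a).1 (terminus a, origin a).2.
Proof. by rewrite edge_sym; exact: (valP a). Qed.

Definition arc_inv (G : sgraph) (a : arc G) : arc G :=
  exist _ (terminus a, origin a) (arc_inv_subproof a).

Definition grover_entry (R : realType) (G : sgraph) (a b : arc G) : R[i] :=
  2 / (degree (terminus b))%:R * (origin a == terminus b)%:R
  - (a == arc_inv b)%:R.

(* Rows and columns are indexed by the arcs through their enumeration. *)
Definition grover (R : realType) (G : sgraph) : 'M[R[i]]_#|{: arc G}| :=
  \matrix_(i, j) grover_entry R (enum_val i) (enum_val j).

Definition periodic (R : realType) (tau : nat) (G : sgraph) : Prop :=
  [/\ (0 < tau)%N,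
      grover R G ^+ tau = 1%:M
    & forall k : nat, (0 < k)%N -> grover R G ^+ k = 1%:M -> (tau <= k)%N].

(* [None] is the vertex shared by all the triangles; [Some (i, false)] and
   [Some (i, true)] are the other two vertices of the i-th triangle. *)
Definition windmill_edge (t : nat) (x y : option ('I_t * bool)) : bool :=
  match x, y with
  | None, None => false
  | None, Some _ | Some _, None => true
  | Some (i, a), Some (j, b) => (i == j) && (a != b)
  end.

Lemma windmill_edge_sym t : symmetric (@windmill_edge t).
Proof. by move=> [[i a]|] [[j b]|] //=; rewrite eq_sym (eq_sym a). Qed.

Lemma windmill_edge_irrefl t : irreflexive (@windmill_edge t).
Proof. by move=> [[i a]|] //=; rewrite !eqxx. Qed.

Definition windmill (t : nat) : sgraph :=
  SGraph (@windmill_edge_sym t) (@windmill_edge_irrefl t).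

(* [inr (i, false)] and [inr (i, true)] are the endpoints of the i-th path;
   [inl c] is the new vertex joined to the endpoints [inr (i, c)]. *)
Definition theta_edge (t : nat) (x y : bool + 'I_t * bool) : bool :=
  match x, y with
  | inl _, inl _ => false
  | inl c, inr (_, b) => c == b
  | inr (_, a), inl c => a == c
  | inr (i, a), inr (j, b) => (i == j) && (a != b)
  end.

Lemma theta_edge_sym t : symmetric (@theta_edge t).
Proof.
by move=> [c|[i a]] [d|[j b]] //=; rewrite eq_sym // (eq_sym a).
Qed.

Lemma theta_edge_irrefl t : irreflexive (@theta_edge t).
Proof. by move=> [c|[i a]] //=; rewrite !eqxx. Qed.

(* The uniform theta graph Theta(t, 2). *)
Definition theta2 (t : nat) : sgraph :=
  SGraph (@theta_edge_sym t) (@theta_edge_irrefl t).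

(* Main.v *)
Require Import Defs.
From mathcomp Require Import all_boot all_order all_algebra.
From mathcomp Require Import complex reals.
From mathcomp Require Import ring lra.

(** Let [P f x] be the mean of [f] over the neighbours of [x], let
    [M = 4 P^2 - 1] and let [S] reverse arcs, so that [U^-1 = S U S].  On
    functions of the form [p (origin a) + q (terminus a)] the walk [U] acts by
    [(p, q) |-> (2 P p + q, - p)].  Comparing [U^3] with [U^-3] on a function of
    the origin, [U^6 = 1] gives [P (M f) x = M f y] for every arc [(x, y)]: thus
    [M f] is constant on the neighbours of each vertex, hence on each class of
    vertices joined by walks of even length.  Applied to the point masses and
    combined with reversibility this says that, for one constant [c > 0] and
    all [x], [y] in a same class,
      [sum_(z ~ x, z ~ y) 1 / d_z = [x = y] d_x / 4 + c d_x d_y].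
    For a vertex of minimal degree these identities force that degree to be at
    most 2, and then all vertices have degree 1, or two vertices of degree 2
    are adjacent; in that case the identities determine the graph.  Conversely,
    on windmills and theta graphs [M f] is a multiple of the sum of [d_z f z]
    over the class, and since [U^2 g - g] lies in the space above for every [g],
    [U^6 = 1] reduces to a computation there. *)

Set Implicit Arguments.
Unset Strict Implicit.
Unset Printing Implicit Defensive.

Import Order.TTheory GRing.Theory Num.Theory.

Local Open Scope ring_scope.

(* [path.arc] shadows the arcs of a graph. *)
Local Notation arc := Defs.arc.

(** * The walk as an operator on functions of ordered pairs *)

Section Walk.

Variables (F : realFieldType) (G : sgraph).
Implicit Types (x y z : G) (f p q : G -> F) (g h : G -> G -> F).

Definition degr x : F := (degree x)%:R.

(** Functions live on all ordered pairs, which avoids the dependent type of arcs. Values off the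
    edges are arbitrary, but never read at an arc; hence the comparison by [eq_arc]. *)
Definition walk g x y : F := 2 / degr x * (\sum_(z | edge x z) g z x) - g y x.

Definition eq_arc g h := forall x y, edge x y -> g x y = h x y.

Definition walk_order k := forall g, eq_arc (iter k walk g) g.

(** The entries of [grover] taken in an ordered field, where inequalities between degrees can be
    used. *)
Definition walk_mx : 'M[F]_#|{: arc G}| :=
  \matrix_(i, j) (2 / degr (terminus (enum_val j))
    * (origin (enum_val i) == terminus (enum_val j))%:R
  - (enum_val i == arc_inv (enum_val j))%:R).

Definition arc_vec g : 'cV[F]_#|{: arc G}| :=
  \col_i g (origin (enum_val i)) (terminus (enum_val i)).

Lemma sum_arc (E : G * G -> F) :
  \sum_(b : arc G) E (val b) = \sum_(p | edge p.1 p.2) E p.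
Proof.
rewrite [RHS](reindex_omap (val : arc G -> G * G) insub); last first.
  by move=> i iA; rewrite insubT.
by apply: eq_bigl => -[i iA] /=; rewrite insubT iA /= eqxx.
Qed.

Lemma arc_inv_eq (a b : arc G) : (a == arc_inv b) = (val b == (terminus a, origin a)).
Proof.
by rewrite -val_eqE; case: a b => [[a1 a2] ?] [[b1 b2] ?] /=; rewrite !xpair_eqE
  (eq_sym a1) (eq_sym a2) andbC.
Qed.

Lemma eq_arc_vec g h : eq_arc g h -> arc_vec g = arc_vec h.
Proof. by move=> gh; apply/colP => i; rewrite !mxE gh //; exact: (valP (enum_val i)). Qed.

Lemma arc_vec_inj g h : arc_vec g = arc_vec h -> eq_arc g h.
Proof.
move=> gh x y xy; have := congr1 (fun v : 'cV_ _ => v (enum_rank (exist _ (x, y) xy : arc G)) 0) gh.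
by rewrite !mxE enum_rankK.
Qed.

Lemma arc_vec_surj (v : 'cV[F]_#|{: arc G}|) : exists g, v = arc_vec g.
Proof.
exists (fun x y => if insub (x, y) is Some a then v (enum_rank (a : arc G)) 0 else 0).
apply/colP => i; rewrite !mxE -surjective_pairing.
by rewrite (valK (enum_val i)) enum_valK.
Qed.

Lemma walk_mxE g : walk_mx *m arc_vec g = arc_vec (walk g).
Proof.
apply/colP => i; rewrite !mxE; set a := enum_val i.
under eq_bigr do rewrite !mxE mulrBl.
rewrite sumrB /walk.
(* The summands of the two Kronecker deltas depend only on the underlying pair, so [sum_arc]
   applies: the first keeps the arcs ending at [origin a], the second only the reverse of [a]. *)
pose E1 (p : G * G) := 2 / degr p.2 * (origin a == p.2)%:R * g p.1 p.2.
pose E2 (p : G * G) := (p == (terminus a, origin a))%:R * g p.1 p.2.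
have bij : {on predT, bijective (@enum_val (arc G) predT)}.
  by apply: onW_bij; exact: enum_val_bij.
congr (_ - _).
  transitivity (\sum_(b : arc G) E1 (val b)).
    by rewrite [RHS](reindex _ bij).
  rewrite sum_arc big_distrr /=.
  rewrite -(pair_big_dep predT (fun x y => edge x y) (fun x y => E1 (x, y))) /=.
  rewrite (exchange_big_dep predT) //= (bigD1 (origin a)) //= [X in _ + X]big1 ?addr0.
    apply: eq_big => z; first by rewrite edge_sym.
    by rewrite /E1 /= eqxx mulr1.
  by move=> z zN; apply: big1 => y _; rewrite /E1 /= eq_sym (negbTE zN) mulr0 mul0r.
transitivity (\sum_(b : arc G) E2 (val b)).
  by rewrite [RHS](reindex _ bij); apply: eq_bigr => j _; rewrite /E2 -arc_inv_eq.
have ea : edge (terminus a) (origin a) by rewrite edge_sym; exact: (valP a).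
rewrite sum_arc (bigD1 (terminus a, origin a)) //= big1 ?addr0.
  by rewrite /E2 eqxx mul1r.
by move=> p /andP[_ /negbTE pN]; rewrite /E2 pN mul0r.
Qed.

Lemma iter_walk_mxE k g : walk_mx ^+ k *m arc_vec g = arc_vec (iter k walk g).
Proof.
by elim: k => [|k IH]; rewrite ?expr0 ?mul1mx // exprS -mulmxE -mulmxA IH walk_mxE.
Qed.

Lemma walk_mx_order k : walk_mx ^+ k = 1%:M <-> walk_order k.
Proof.
split=> [Uk g|Uk].
  by apply: arc_vec_inj; rewrite -iter_walk_mxE Uk mul1mx.
(* Column [j] of the power is its value on a basis vector, which is the arc vector of some [g]. *)
apply/matrixP => i j; have [g Eg] := arc_vec_surj (delta_mx j 0).
have := congr1 (fun v : 'cV_ _ => v i 0) (iter_walk_mxE k g).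
rewrite (eq_arc_vec (Uk g)) -Eg !mxE => E.
rewrite andbT in E; rewrite -E (bigD1 j) //= big1 ?addr0.
  by rewrite mxE !eqxx mulr1.
by move=> l /negbTE lj; rewrite mxE lj mulr0.
Qed.

End Walk.

(** The entries of the Grover matrix are real, and embedding the reals into [R[i]] is injective on
    matrices and compatible with powers. *)
Lemma grover_order (R : realType) (G : sgraph) k :
  grover R G ^+ k = 1%:M <-> walk_order R G k.
Proof.
rewrite -walk_mx_order.
have -> : grover R G = map_mx (real_complex R) (walk_mx R G).
  apply/matrixP => i j; rewrite !mxE /grover_entry.
  by rewrite rmorphB rmorphM fmorph_div !rmorph_nat.
have mapX n (A : 'M[R]_n) : map_mx (real_complex R) A ^+ k = map_mx (real_complex R) (A ^+ k).
  by elim: k => [|k IH]; rewrite ?expr0 ?map_mx1 // !exprS -!mulmxE map_mxM IH.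
rewrite mapX; split=> [E|->]; last exact: map_mx1.
by apply: (@map_mx_inj R _ (real_complex R)); rewrite E map_mx1.
Qed.

(** * Functions of the origin and of the terminus *)

Section Average.

Variables (F : realFieldType) (G : sgraph).
Hypothesis degree_gt0 : forall x : G, (0 < degree x)%N.
Implicit Types (x y z : G) (f p q : G -> F) (g : G -> G -> F).

Local Notation deg := (degr F).

Lemma deg_gt0 x : 0 < deg x. Proof. by rewrite ltr0n. Qed.

Lemma deg_neq0 x : deg x != 0. Proof. by rewrite gt_eqF ?deg_gt0. Qed.

Lemma sum_nbrs_const x (a : F) : \sum_(z | edge x z) a = deg x * a.
Proof. by rewrite sumr_const mulr_natl /degree cardsE. Qed.

Definition avg f x : F := (deg x)^-1 * \sum_(z | edge x z) f z.

Lemma eq_avg_nbrs f (h : G -> F) x : (forall z, edge x z -> f z = h z) -> avg f x = avg h x.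
Proof. by move=> fh; congr (_ * _); apply: eq_bigr. Qed.

Lemma avg_lin a b f (h : G -> F) x :
  avg (fun z => a * f z + b * h z) x = a * avg f x + b * avg h x.
Proof. by rewrite /avg big_split /= -!mulr_sumr; ring. Qed.

Lemma avgZ a f x : avg (fun z => a * f z) x = a * avg f x.
Proof. by rewrite /avg -mulr_sumr; ring. Qed.

Lemma avg_cst_nbrs f x a : (forall z, edge x z -> f z = a) -> avg f x = a.
Proof.
move=> fa; rewrite (eq_avg_nbrs (h := fun=> a)) // /avg sum_nbrs_const.
by rewrite mulKf ?deg_neq0.
Qed.

Definition lift p q x y := p x + q y.

Lemma eq_arc_walk g (h : G -> G -> F) : eq_arc g h -> eq_arc (walk g) (walk h).
Proof.
move=> gh x y xy; rewrite /walk gh 1?edge_sym //; congr (_ * _ - _).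
by apply: eq_bigr => z xz; rewrite gh 1?edge_sym.
Qed.

(** Summing [q x] over the neighbours of [x] gives [deg x * q x], so [2 q - q = q] survives at the
    origin. The image is described pointwise, so that uses can supply simplified functions without
    extensionality. *)
Lemma walk_lift g p q p' q' :
    eq_arc g (lift p q) ->
    (forall x, p' x = 2 * avg p x + q x) -> (forall x, q' x = - p x) ->
  eq_arc (walk g) (lift p' q').
Proof.
move=> gpq p'E q'E x y xy; rewrite (eq_arc_walk gpq) // /walk /lift p'E q'E.
by rewrite big_split /= sum_nbrs_const /avg; field; apply: deg_neq0.
Qed.

(** The operator [M] of the overview; the coefficient [(-1)] makes it match [avg_lin] under a
    further mean. *)
Definition lap f x : F := 4 * avg (avg f) x + (-1) * f x.

(** The successive pairs are [(f, 0)], [(2 P f, - f)], [(M f, - 2 P f)] and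
    [(2 P (M f) - 2 P f, - M f)]. *)
Lemma walk3_lift g f :
  eq_arc g (lift f (fun=> 0)) ->
  eq_arc (walk (walk (walk g)))
    (lift (fun x => 2 * avg (lap f) x - 2 * avg f x) (fun x => - lap f x)).
Proof.
move=> g0.
apply: (@walk_lift _ (lap f) (fun x => -2 * avg f x)) => [|x|x]; last 2 first.
- by ring.
- by [].
apply: (@walk_lift _ (fun x => 2 * avg f x) (fun x => - f x)) => [|x|x]; last 2 first.
- by rewrite /lap avgZ; ring.
- by ring.
by apply: (walk_lift g0) => x; rewrite ?addr0.
Qed.

(* [lift (- 2 P f) (M f)] is [U^-3] applied to the function [f] of the origin. *)
Lemma lap_mean f x y : walk_order F G 6 -> edge x y -> avg (lap f) x = lap f y.
Proof.
move=> U6 xy; pose g0 := lift (fun x => -2 * avg f x) (lap f).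
have g3 : eq_arc (walk (walk (walk g0))) (lift f (fun=> 0)).
  apply: (@walk_lift _ (fun=> 0) f) => [|z|z]; last 2 first.
  - by rewrite (avg_cst_nbrs (a := 0)) //; ring.
  - by rewrite oppr0.
  apply: (@walk_lift _ (fun z => -1 * f z) (fun z => 2 * avg f z)) => [|z|z]; last 2 first.
  - by rewrite avgZ; ring.
  - by ring.
  apply: (@walk_lift _ (fun x => -2 * avg f x) (lap f)) => // z; last by ring.
  by rewrite avgZ /lap; ring.
(* Equating [U^3 f] with [g0 = U^-3 f] on the arc, the terms in [avg f x] cancel. *)
have := U6 g0 _ _ xy; rewrite /= (walk3_lift g3) // /g0 /lift => E.
lra.
Qed.

(** Used with point masses to refute [U^2 = 1] on the two families; [walk_cube_lift] serves the same
    purpose for [U^3]. *)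
Lemma walk_square_lift f x y :
    walk_order F G 2 -> edge x y ->
  lap f x - 2 * avg f y = f x.
Proof.
move=> U2 xy; have /= := U2 (lift f (fun=> 0)) _ _ xy.
rewrite (@walk_lift _ (fun x => 2 * avg f x) (fun x => - f x)
  (lap f) (fun x => -2 * avg f x)) //.
- by rewrite /lift => E; lra.
- apply: (@walk_lift _ f (fun=> 0)) => // z; ring.
- by move=> z; rewrite avgZ /lap; ring.
- by move=> z; ring.
Qed.

Lemma walk_cube_lift f x y :
    walk_order F G 3 -> edge x y ->
  2 * avg (lap f) x - 2 * avg f x - lap f y = f x.
Proof.
move=> U3 xy; have /= := U3 (lift f (fun=> 0)) _ _ xy.
by rewrite (@walk3_lift _ f) // /lift => E; lra.
Qed.

(* [U^2 g - g = lift p q], so that [U^6 g - g = (1 + U^2 + U^4) (lift p q)];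
   [r] plays the role of the relation "joined by a walk of even length". *)
Lemma walk_order6 (r : rel G) (k : F) :
    (forall x y z w, edge x y -> edge z w -> r x z = r y w) ->
    (forall f x, lap f x = k * \sum_(z | r x z) deg z * f z) ->
  walk_order F G 6.
Proof.
move=> r_edge lapE.
(* For neighbours [y], [z] of [x] and [v] of [w], [r z w = r x v = r y w]; so [lap f] is constant on
   the neighbours of [x]. *)
have mean f x y : edge x y -> avg (lap f) x = lap f y.
  move=> xy; apply: avg_cst_nbrs => z xz; rewrite !lapE; congr (_ * _).
  apply: eq_bigl => w; have /card_gt0P[v] := degree_gt0 w.
  rewrite inE => wv.
  by rewrite (r_edge z x w v) 1?(r_edge y x w v) // edge_sym.
have mean4 f x y : edge x y -> 4 * avg (avg (avg f)) x - avg f x = 4 * avg (avg f) y - f y.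
  by move=> /mean-/(_ f); rewrite /lap avg_lin => E; lra.
move=> g.
(* [al] collects the arcs into [x], [be] the arcs out of [x]. On an arc, [U g = al x - g y x], and
   therefore [U^2 g = g + (2 P al - be) x - al y]. *)
pose al x : F := 2 / deg x * \sum_(z | edge x z) g z x.
pose be x : F := 2 / deg x * \sum_(z | edge x z) g x z.
(* Both sides sum [2 * g] over the arcs [(w, z)] with [r y z], equivalently [r x w]: once grouped by
   terminus, once by origin. *)
have albe x y : edge x y -> lap al y = lap be x.
  move=> xy; rewrite !lapE; congr (_ * _).
  transitivity (\sum_(z | r y z) \sum_(w | edge z w) 2 * g w z).
    by apply: eq_bigr => z _; rewrite -mulr_sumr /al; field; apply: deg_neq0.
  transitivity (\sum_(w | r x w) \sum_(z | edge w z) 2 * g w z); last first.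
    by apply: eq_bigr => z _; rewrite -mulr_sumr /be; field; apply: deg_neq0.
  rewrite (exchange_big_dep predT) //= big_mkcond [RHS]big_mkcond /=.
  apply: eq_bigr => w _.
  have rE z : r y z && edge z w = r x w && edge w z.
    rewrite (edge_sym z); case wz: (edge w z); rewrite ?andbF // !andbT.
    by rewrite -(r_edge x y w z).
  by under eq_bigl do rewrite rE; case: (r x w); rewrite /= ?big_pred0_eq.
pose p x : F := 2 * avg al x + (-1) * be x; pose q x : F := -1 * al x.
(* Iterates of [(p, q)] under [U]; the explicit coefficients 1 and -1 fit [avg_lin] and [avgZ]. *)
pose p1 x : F := 2 * avg p x + 1 * q x; pose q1 x : F := -1 * p x.
pose p2 x : F := 2 * avg p1 x + 1 * q1 x; pose q2 x : F := -1 * p1 x.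
pose p3 x : F := 2 * avg p2 x + 1 * q2 x; pose q3 x : F := -1 * p2 x.
pose p4 x : F := 2 * avg p3 x + 1 * q3 x; pose q4 x : F := -1 * p3 x.
have walkD (g1 h1 h2 : G -> G -> F) : eq_arc g1 (fun x y => h1 x y + h2 x y) ->
  eq_arc (walk g1) (fun x y => walk h1 x y + walk h2 x y).
  move=> gh x y xy; rewrite (eq_arc_walk gh) // /walk big_split /=; ring.
have walk_sq g1 h : eq_arc g1 (fun x y => g x y + h x y) ->
    eq_arc (walk (walk g1)) (fun x y => g x y + (lift p q x y + walk (walk h) x y)).
  move=> gh x y xy; rewrite (walkD _ _ _ (walkD _ _ _ gh)) // [RHS]addrA; congr (_ + _).
  rewrite /lift /p /q {1}/walk.
  have -> : \sum_(z | edge x z) walk g z x = deg x * avg al x - \sum_(z | edge x z) g x z.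
    by rewrite /avg mulVKf ?deg_neq0 // -sumrB.
  by rewrite {1}/walk -/(al y) /be; field; apply: deg_neq0.
have L1 h p0 q0 : eq_arc h (lift p0 q0) ->
    eq_arc (walk h) (lift (fun x => 2 * avg p0 x + 1 * q0 x) (fun x => -1 * p0 x)).
  by move=> hE; apply: (walk_lift hE) => x; ring.
have g2 : eq_arc (iter 2 (@walk F G) g) (fun x y => g x y + lift p q x y).
  have g0 : eq_arc g (fun x y => g x y + 0) by move=> x y _; rewrite addr0.
  move=> x y xy; rewrite /= (walk_sq g (fun _ _ => 0) g0) //.
  have w0 z w : walk (fun _ _ : G => 0 : F) z w = 0 by rewrite /walk big1_eq mulr0 subr0.
  rewrite (eq_arc_walk (h := fun _ _ => 0)) ?w0 ?addr0 // => ? ? _; exact: w0.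
move=> x y xy; rewrite -[iter 6 _ _]/(walk (walk (iter 4 (@walk F G) g))).
rewrite (walk_sq _ _ (walk_sq _ _ g2)) //.
rewrite (walkD _ _ _ (walkD _ _ _ (fun _ _ _ => erefl))) //.
have l2 : eq_arc (walk (walk (lift p q))) (lift p2 q2) 
  by apply: (L1 _ p1 q1); apply: (L1 _ p q).
have l4 : eq_arc (walk (walk (lift p2 q2))) (lift p4 q4).
  by apply: (L1 _ p3 q3); apply: (L1 _ p2 q2).
rewrite l2 // (eq_arc_walk (eq_arc_walk l2)) // l4 //.
suff S : lift p q x y + (lift p2 q2 x y + lift p4 q4 x y) = 0 by rewrite S addr0.
have yx : edge y x by rewrite edge_sym.
have avg_p1 z : avg p1 z = 2 * avg (avg p) z + 1 * avg q z by exact: avg_lin.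
have avg_p2 z : avg p2 z = 2 * avg (avg p1) z + 1 * avg q1 z by exact: avg_lin.
have avg_p3 z : avg p3 z = 2 * avg (avg p2) z + 1 * avg q2 z by exact: avg_lin.
have avg_q1 z : avg q1 z = -1 * avg p z by exact: avgZ.
have avg_q2 z : avg q2 z = -1 * avg p1 z by exact: avgZ.
have aavg_p1 z : avg (avg p1) z = 2 * avg (avg (avg p)) z + 1 * avg (avg q) z.
  by rewrite -avg_lin; apply: eq_avg_nbrs => w _.
have aavg_q1 z : avg (avg q1) z = -1 * avg (avg p) z.
  by rewrite -avgZ; apply: eq_avg_nbrs => w _.
have aavg_p2 z : avg (avg p2) z = 2 * avg (avg (avg p1)) z + 1 * avg (avg q1) z.
  by rewrite -avg_lin; apply: eq_avg_nbrs => w _.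
have aaavg_p1 z : avg (avg (avg p1)) z = 2 * avg (avg (avg (avg p))) z + 1 * avg (avg (avg q)) z.
  by rewrite -avg_lin; apply: eq_avg_nbrs => w _.
(* Since [M] commutes with [P], [mean] and [albe] turn [lap (avg al) x] into [lap be x]. With
   [lap_q] this gives [lap p x + lap q y = 0]. *)
have lap_p : lap p x = 2 * lap be x + (-1) * lap be x.
  have -> : lap p x = 2 * lap (avg al) x + (-1) * lap be x.
    rewrite /lap (eq_avg_nbrs (f := avg p) (h := fun z => 2 * avg (avg al) z + (-1) * avg be z)).
      by rewrite avg_lin /p; ring.
    by move=> z _; exact: avg_lin.
  rewrite -(albe _ _ xy) -(mean al _ _ xy); congr (_ * _ + _).
  by rewrite {2}/lap avg_lin.
have lap_q : lap q y = - lap be x.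
  rewrite -(albe _ _ xy) /lap (eq_avg_nbrs (f := avg q) (h := fun z => -1 * avg al z)).
    by rewrite avgZ /q; ring.
  by move=> z _; exact: avgZ.
have mp := mean4 p _ _ xy; have mp' := mean4 p _ _ yx.
have mPp := mean4 (avg p) _ _ xy; have mq := mean4 q _ _ xy.
rewrite /lap in lap_p lap_q; rewrite /lift.
have [p1E q1E] : (forall z, p1 z = 2 * avg p z + 1 * q z) /\ (forall z, q1 z = -1 * p z) by [].
have [p2E q2E] : (forall z, p2 z = 2 * avg p1 z + 1 * q1 z) /\ (forall z, q2 z = -1 * p1 z) by [].
have [p3E q3E] : (forall z, p3 z = 2 * avg p2 z + 1 * q2 z) /\ (forall z, q3 z = -1 * p2 z) by [].
have [p4E q4E] : (forall z, p4 z = 2 * avg p3 z + 1 * q3 z) /\ (forall z, q4 z = -1 * p3 z) by [].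
(* Once opaque, the iterates unfold only through the equations above, and the goal becomes linear in
   the iterated means of [p] and [q] at [x] and [y]. *)
clearbody p4 q4 p3 q3 p2 q2 p1 q1.
rewrite !(p4E, q4E, p3E, q3E, p2E, q2E, p1E, q1E).
rewrite !(avg_p3, aavg_p2, aaavg_p1, avg_p2, aavg_p1, avg_p1, avg_q2, aavg_q1, avg_q1, avg_p1).
lra.
Qed.

End Average.

(** * The codegree identities *)

Section EvenWalks.

Variable G : sgraph.
Implicit Types (x y z v w : G).

Definition two_step x y := [exists z, edge x z && edge z y].

Definition even_conn := connect two_step.

Lemma two_step_sym : symmetric two_step.
Proof.
by move=> x y; apply/existsP/existsP => -[z /andP[xz zy]]; exists z;
  rewrite edge_sym zy edge_sym.
Qed.

Lemma even_conn_sym : symmetric even_conn.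
Proof. exact: sym_connect_sym two_step_sym. Qed.

Lemma even_conn_nbrs x y z : edge z x -> edge z y -> even_conn x y.
Proof. by move=> zx zy; apply/connect1/existsP; exists z; rewrite edge_sym zx. Qed.

(** Extending an even walk from [x] to [z] by one edge at each end gives an even walk from [y] to
    [w]. *)
Lemma even_conn_edge x y z w : edge x y -> edge z w -> even_conn x z = even_conn y w.
Proof.
suff imp x' y' z' w' : edge x' y' -> edge z' w' -> even_conn x' z' -> even_conn y' w'.
  by move=> xy zw; apply/idP/idP; apply: imp; rewrite // edge_sym.
move=> {x y z w} xy zw /connectP[p]; elim: p x' y' xy => [|x1 p IH] x y xy /=.
  by move=> _ zx; rewrite zx in zw; exact: even_conn_nbrs xy zw.
move=> /andP[/existsP[a /andP[xa ax1]] px1] lx1.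
by apply: connect_trans (even_conn_nbrs xy xa) (IH _ _ _ px1 lx1); rewrite edge_sym.
Qed.

(** Along a walk from [x], each further edge exchanges the two alternatives. *)
Lemma even_conn_total x y v :
  connected G -> edge x y -> even_conn x v || even_conn y v.
Proof.
move=> G_conn xy; have /connectP[p] := G_conn x v.
elim/last_ind: p v => [|p w IH] v /=; first by move=> _ ->; rewrite /even_conn connect0.
rewrite rcons_path last_rcons => /andP[px pw] ->.
have yx : edge y x by rewrite edge_sym.
by have := IH _ px erefl; rewrite orbC (even_conn_edge xy pw) (even_conn_edge yx pw).
Qed.

End EvenWalks.

(** * Neighbourhoods of vertices of degree one and two *)

Section Neighbours.

Variable G : sgraph.
Implicit Types (x y z v w : G).

Lemma degree_rem x y : edge x y -> degree x = #|[set z | edge x z && (z != y)]|.+1.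
Proof.
move=> xy; rewrite /degree (cardsD1 y) inE xy add1n; congr _.+1.
by apply: eq_card => z; rewrite !inE andbC.
Qed.

Lemma nbrs1 x y : degree x = 1%N -> edge x y -> forall z, edge x z = (z == y).
Proof.
move=> dx xy z; move: dx; rewrite (degree_rem xy) => -[] /eqP; rewrite cards_eq0 => /eqP N0.
have := in_set0 z; rewrite -N0 inE; have [->|_] := eqVneq z y; first by rewrite xy.
by rewrite andbT.
Qed.

Lemma nbrs2 x y : degree x = 2%N -> edge x y ->
  exists2 a, a != y & forall z, edge x z = (z == y) || (z == a).
Proof.
move=> dx xy; move: dx; rewrite (degree_rem xy) => -[] /eqP/cards1P[a Na].
have in_a z : edge x z && (z != y) = (z == a) by have := in_set1 z a; rewrite -Na inE.
exists a; first by have := in_a a; rewrite eqxx => /andP[].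
move=> z; rewrite -in_a; have [->|_] := eqVneq z y; first by rewrite xy.
by rewrite andbT.
Qed.

Lemma edge_neq x y : edge x y -> x != y.
Proof. by apply: contraTneq => ->; rewrite edge_irrefl. Qed.

End Neighbours.

Section Codegree.

Variables (F : realFieldType) (G : sgraph).
Hypothesis degree_gt0 : forall x : G, (0 < degree x)%N.
Implicit Types (x y z v w : G).

Local Notation deg := (degr F).
Local Notation deg_gt0 := (@deg_gt0 F G degree_gt0).
Local Notation deg_neq0 := (@deg_neq0 F G degree_gt0).

(** [codeg x y / deg x] is the two-step transition probability of the simple random walk, that is,
    the entry of [P^2]. *)
Definition codeg x y : F := \sum_(z | edge x z && edge y z) (deg z)^-1.

Lemma codegC x y : codeg x y = codeg y x.
Proof. by apply: eq_bigl => z; rewrite andbC. Qed.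

Lemma codegxx x : codeg x x = \sum_(z | edge x z) (deg z)^-1.
Proof. by apply: eq_bigl => z; rewrite andbb. Qed.

Lemma codeg_eq0 x y : ~~ even_conn x y -> codeg x y = 0.
Proof.
move=> nxy; rewrite /codeg big_pred0 // => z; apply: contraNF nxy => /andP[xz yz].
by apply: (@even_conn_nbrs _ _ _ z); rewrite edge_sym.
Qed.

Lemma codeg_common x y : codeg x y != 0 -> exists2 z, edge x z & edge y z.
Proof.
move=> W0; have /existsP[z /andP[xz yz]] : [exists z, edge x z && edge y z]; last by exists z.
by apply: contra_neqT W0 => /existsPn N; rewrite /codeg big_pred0 // => z; apply/negbTE.
Qed.

Lemma codeg_ge x y z : edge z x -> edge z y -> (deg z)^-1 <= codeg x y.
Proof.
move=> zx zy; rewrite /codeg (bigD1 z) /=; last by rewrite !(edge_sym _ z) zx.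
by rewrite lerDl sumr_ge0 // => w _; rewrite invr_ge0 ltW ?deg_gt0.
Qed.

Lemma sum_codeg x : \sum_y codeg x y = deg x.
Proof.
rewrite (exchange_big_dep (fun z => edge x z)) /=; last by move=> ? ? _ /andP[].
rewrite -[RHS]mulr1 -(sum_nbrs_const x (1 : F)); apply: eq_bigr => z xz.
under eq_bigl => y do rewrite xz edge_sym /=.
by rewrite sum_nbrs_const mulfV ?deg_neq0.
Qed.

Lemma lap_delta x v :
  lap (fun z => (z == v)%:R) x = 4 * codeg x v / deg x - (x == v)%:R.
Proof.
have avg1 z : avg (fun z => (z == v)%:R : F) z = (edge z v)%:R / deg z.
  rewrite /avg mulrC big_mkcond (bigD1 v) //= big1 ?addr0 ?eqxx; first by case: edge.
  by move=> w /negbTE->; case: ifP.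
rewrite /lap {1}/avg (eq_bigr (fun z => (edge z v)%:R / deg z)) => [|z _]; last exact: avg1.
have -> : \sum_(z | edge x z) (edge z v)%:R / deg z = codeg x v.
  rewrite /codeg [RHS]big_mkcondr; apply: eq_bigr => z _.
  by rewrite (edge_sym v); case: edge; rewrite ?mul1r ?mul0r.
by field; apply: deg_neq0.
Qed.

Definition codeg_law c :=
  forall x y, even_conn x y -> codeg x y = (x == y)%:R * deg x / 4 + c * deg x * deg y.

Hypothesis G_conn : connected G.

(** [M] sends the point mass at [v] to a function with constant value [kap v] on the class of [v].
    As [codeg] is symmetric, so is [deg x * kap y]; hence [kap] is proportional to the degree on a
    class, and the row sums of [4 P^2 - 1] fix the factor. *)
Lemma codeg_law_ex (x0 : G) : walk_order F G 6 -> exists2 c, 0 < c & codeg_law c.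
Proof.
move=> U6.
pose del v z : F := (z == v)%:R; pose kap v := lap (del v) v.
have lap_even f x y : even_conn x y -> lap f x = lap f y :> F.
  case/connectP=> p px ->; elim: p x px => //= x1 p IH x.
  move=> /andP[/existsP[z /andP[xz zx1]] /IH <-].
  by rewrite -!(lap_mean degree_gt0 _ U6 (x := z)) // edge_sym.
have kapE x y : even_conn x y -> deg x * kap y = 4 * codeg x y - (x == y)%:R * deg x.
  by move=> xy; rewrite /kap -(lap_even _ _ _ xy) lap_delta; field; apply: deg_neq0.
have kapC x y : even_conn x y -> deg x * kap y = deg y * kap x.
  move=> xy; rewrite kapE // kapE; last by rewrite even_conn_sym.
  rewrite codegC eq_sym.
  by have [->|] := eqVneq x y; rewrite ?mul0r.
pose V x : F := \sum_(z | even_conn x z) deg z.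
have Vgt0 x : 0 < V x.
  rewrite /V (bigD1 x) ?[even_conn _ _]connect0 //= ltr_wpDr ?deg_gt0 //.
  by apply: sumr_ge0 => z _; rewrite ltW ?deg_gt0.
(* The arcs leaving the class of [x] are the reverses of those leaving the class of [y], so a single
   constant serves both classes. *)
have Vedge x y : edge x y -> V x = V y.
  move=> xy; rewrite /V.
  transitivity (\sum_(z | even_conn x z) \sum_(w | edge z w) (1 : F)).
    by apply: eq_bigr => z _; rewrite sum_nbrs_const mulr1.
  rewrite (exchange_big_dep predT) //= [RHS]big_mkcond /=; apply: eq_bigr => w _.
  have rE z : even_conn x z && edge z w = even_conn y w && edge w z.
    rewrite (edge_sym z); case wz: (edge w z); rewrite ?andbF // !andbT.
    by rewrite (even_conn_edge xy (w := w)) // edge_sym.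
  under eq_bigl do rewrite rE; case: ifP => _ /=; last exact: big_pred0_eq.
  by rewrite sum_nbrs_const mulr1.
have VE x : V x = V x0.
  have /connectP[p px ->] := G_conn x x0; elim: p x px => //= x1 p IH x.
  by move=> /andP[/Vedge-> /IH].
(* Summing [kapE] over the class: [codeg x] has total [deg x], whence [4 - 1 = 3]. *)
have kap_V x : kap x * V x0 = 3 * deg x.
  rewrite -(VE x) mulr_sumr.
  transitivity (\sum_(z | even_conn x z) deg x * kap z).
    by apply: eq_bigr => z xz; rewrite (kapC _ _ xz) mulrC.
  transitivity (\sum_(z | even_conn x z) (4 * codeg x z - (x == z)%:R * deg x)).
    by apply: eq_bigr => z xz; rewrite kapE.
  transitivity (\sum_z (4 * codeg x z - (x == z)%:R * deg x)).
    rewrite big_mkcond; apply: eq_bigr => z _; case: ifPn => // nxz.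
    rewrite codeg_eq0 // (_ : x == z = false) ?mul0r ?mulr0 ?subr0 //.
    by apply: contraNF nxz => /eqP->; exact: connect0.
  rewrite sumrB -mulr_sumr sum_codeg -mulr_suml (bigD1 x) //= big1 => [|z].
    by rewrite eqxx mulr1n; ring.
  by rewrite eq_sym => /negbTE->.
exists (3 / (4 * V x0)); first by rewrite divr_gt0 ?mulr_gt0.
move=> x y xy; have := kapE _ _ xy.
have -> : kap y = 3 * deg y / V x0 by rewrite -kap_V mulfK // gt_eqF.
by move=> E; rewrite (_ : codeg x y = (4 * codeg x y) / 4); last (by field);
  rewrite (_ : 4 * _ = deg x * (3 * deg y / V x0) + (x == y)%:R * deg x); last (by lra);
  field; rewrite gt_eqF.
Qed.

End Codegree.

(** * Graphs satisfying the codegree identities *)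

Section Shapes.

Variable G : sgraph.

(** Local form of a windmill with hub [z]: the other vertices are matched in pairs. *)
Definition windmill_like := exists2 z : G, (exists v, edge z v) &
  forall v, v != z -> edge z v /\ degree v = 2%N.

(** Local form of a theta graph with poles [p] and [q]: removing them leaves a perfect matching
    between the neighbours of [p] and those of [q]. *)
Definition theta_like := exists p q : G,
  [/\ p != q, ~~ edge p q, exists v, edge p v,
      forall v, v != p -> v != q -> degree v = 2%N /\ edge p v = ~~ edge q v
    & (forall v w, edge p v -> edge v w -> w != p -> edge q w) /\
      (forall v w, edge q v -> edge v w -> w != q -> edge p w)].

End Shapes.

Section Classification.

Variables (F : realFieldType) (G : sgraph) (c : F).
Hypothesis degree_gt0 : forall x : G, (0 < degree x)%N.
Hypothesis G_conn : connected G.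
Hypothesis c_gt0 : 0 < c.
Hypothesis codegE : @codeg_law F G c.
Implicit Types (x y z v w : G).

Local Notation deg := (degr F).
Local Notation codeg := (@codeg F G).
Local Notation deg_gt0 := (@deg_gt0 F G degree_gt0).
Local Notation deg_neq0 := (@deg_neq0 F G degree_gt0).

Lemma c_neq0 : c != 0.
Proof. by rewrite gt_eqF. Qed.

Lemma sum_invdeg x : \sum_(z | edge x z) (deg z)^-1 = deg x / 4 + c * deg x ^+ 2.
Proof. by rewrite -codegxx codegE ?eqxx ?mulr1n; [ring | exact: connect0]. Qed.

Lemma codeg_neq x y : even_conn x y -> x != y -> codeg x y = c * deg x * deg y.
Proof. by move=> xy /negbTE nxy; rewrite codegE // nxy !mul0r add0r. Qed.

Lemma common_nbr x y : even_conn x y -> x != y -> exists2 z, edge x z & edge y z.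
Proof.
by move=> xy nxy; apply: (@codeg_common F); rewrite codeg_neq // !mulf_neq0 ?deg_neq0 ?gt_eqF.
Qed.

Lemma invdeg_le x y v : edge y x -> edge y v -> x != v -> (deg y)^-1 <= c * deg x * deg v.
Proof.
move=> yx yv nxv; rewrite -codeg_neq ?codeg_ge //; exact: even_conn_nbrs yx yv.
Qed.

Lemma sum_nbrs_le x y (f : G -> F) a :
    edge y x -> (forall v, edge y v -> v != x -> f v <= a) ->
  \sum_(v | edge y v) f v <= f x + (deg y - 1) * a.
Proof.
move=> yx fa; rewrite (bigD1 x) //= lerD2l.
have -> : (deg y - 1) * a = \sum_(v | edge y v && (v != x)) a.
  by rewrite mulrBl mul1r -(sum_nbrs_const y a) (bigD1 x) //=; ring.
by apply: ler_sum => v /andP[yv nvx]; apply: fa.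
Qed.

Lemma sum_nbrs1 x y (f : G -> F) :
  (forall z, edge x z = (z == y)) -> \sum_(z | edge x z) f z = f y.
Proof. by move=> Nx; rewrite (eq_bigl _ _ Nx) big_pred1_eq. Qed.

Lemma sum_nbrs2 x y z (f : G -> F) :
    z != y -> (forall w, edge x w = (w == y) || (w == z)) ->
  \sum_(w | edge x w) f w = f y + f z.
Proof.
move=> nzy Nx; rewrite (eq_bigl _ _ Nx) (bigD1 y) ?eqxx //=; congr (_ + _).
apply: big_pred1 => w /=; have [->|_] := eqVneq w y; last by rewrite andbT.
by rewrite eq_sym (negbTE nzy).
Qed.

Lemma codeg_sum x v : codeg x v = \sum_(z | edge x z) if edge v z then (deg z)^-1 else 0 : F.
Proof. exact: big_mkcondr. Qed.

Lemma codeg_nbrs2 x y z v :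
    z != y -> (forall w, edge x w = (w == y) || (w == z)) ->
    even_conn x v -> x != v ->
  (if edge v y then (deg y)^-1 else 0 : F) + (if edge v z then (deg z)^-1 else 0 : F) = c * deg x * deg v :> F.
Proof. by move=> nzy Nx xv nxv; rewrite -codeg_neq // codeg_sum (sum_nbrs2 _ nzy Nx). Qed.

Lemma degE x n : degree x = n -> deg x = n%:R.
Proof. by rewrite /degr => ->. Qed.

Lemma deg_inj x n : deg x = n%:R -> degree x = n.
Proof. by move=> /eqP; rewrite eqr_nat => /eqP. Qed.

(* [lra] does not see section hypotheses and stumbles on equations in [nat]. *)
Local Ltac deg_lra :=
  repeat match goal with H : @eq nat _ _ |- _ => clear H end;
  have := c_gt0; move=> ?; lra.

(** Let [z] and [x1] be the other neighbours of [x] and [y]. The law at [x] and at [y] gives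
    [1 / d_z = 1 / d_x1 = 4 c]. Against [x], the law then makes each [v] of its class not adjacent
    to [y] a neighbour of [z] of degree 2; likewise for [y] and [x1]. The case [z = x1] yields a
    windmill, the other a theta graph. *)
Lemma adjacent_degree2 x y :
  edge x y -> degree x = 2%N -> degree y = 2%N -> windmill_like G \/ theta_like G.
Proof.
move=> xy dx dy; have yx : edge y x by rewrite edge_sym.
have [z nzy Nx] := nbrs2 dx xy; have [x1 nx1x Ny] := nbrs2 dy yx.
have xz : edge x z by rewrite Nx eqxx orbT.
have yx1 : edge y x1 by rewrite Ny eqxx orbT.
have [Dx Dy] := (degE dx, degE dy).
have uz : (deg z)^-1 = 4 * c.
  by have := sum_invdeg x; rewrite (sum_nbrs2 _ nzy Nx) Dx Dy => E; deg_lra.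
have ux1 : (deg x1)^-1 = 4 * c.
  by have := sum_invdeg y; rewrite (sum_nbrs2 _ nx1x Ny) Dx Dy => E; deg_lra.
have nxz := edge_neq xz; have nyx1 := edge_neq yx1.
have far v : even_conn x v -> x != v -> ~~ edge v y -> edge v z /\ degree v = 2%N.
  move=> xv nxv /negbTE nvy; have := codeg_nbrs2 nzy Nx xv nxv.
  rewrite nvy add0r uz Dx; have Dv := deg_gt0 v; case: (edge v z) => E.
    split=> //; apply: deg_inj; apply: (mulfI c_neq0).
    by deg_lra.
  by exfalso; have := mulr_gt0 c_gt0 Dv; deg_lra.
have far' v : even_conn y v -> y != v -> ~~ edge v x -> edge v x1 /\ degree v = 2%N.
  move=> yv nyv /negbTE nvx; have := codeg_nbrs2 nx1x Ny yv nyv.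
  rewrite nvx add0r ux1 Dy; have Dv := deg_gt0 v; case: (edge v x1) => E.
    split=> //; apply: deg_inj; apply: (mulfI c_neq0).
    by deg_lra.
  by exfalso; have := mulr_gt0 c_gt0 Dv; deg_lra.
have [Ez|nzx1] := eqVneq z x1.
  subst x1; left; exists z; first by exists x; rewrite edge_sym.
  have exy : even_conn x y by apply: (@even_conn_nbrs _ _ _ z); rewrite edge_sym.
  move=> v nvz; have xv : even_conn x v.
    case/orP: (even_conn_total v G_conn xy) => // yv; exact: connect_trans exy yv.
  have [<-|nxv] := eqVneq x v; first by rewrite edge_sym.
  have [Ev|nvy] := eqVneq v y; first by rewrite Ev edge_sym.
  have [|vz dv] := far v xv nxv; last by rewrite edge_sym.
  by rewrite edge_sym Ny negb_or nvz eq_sym nxv.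
(* Otherwise [y] and [z] are common neighbours of [x] and [x1], and the law reads
   [1/2 + 4 c = 2 c d_x1 = 1/2]. *)
have nzx1e : ~~ edge z x1.
  have := codeg_nbrs2 nzy Nx (even_conn_nbrs yx yx1); rewrite eq_sym nx1x => /(_ isT).
  rewrite (edge_sym x1 y) yx1 (edge_sym x1 z) uz Dy Dx; case: edge => //.
  have : deg x1 * (4 * c) = 1 by rewrite -ux1 mulfV ?deg_neq0.
  by move=> E1 E2; exfalso; deg_lra.
(* Distinct vertices of one class share a neighbour, but the neighbourhoods [{y, z}] and [{x, x1}]
   are disjoint. *)
have nexy : ~~ even_conn x y.
  apply/negP => exy; have [w] := common_nbr exy (edge_neq xy).
  rewrite Nx Ny => /orP[]/eqP-> /orP[]/eqP E.
  - by rewrite E edge_irrefl in xy.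
  - by rewrite E eqxx in nyx1.
  - by rewrite E eqxx in nxz.
  - by rewrite E eqxx in nzx1.
have zN v : even_conn x v -> v != x1 -> edge z v /\ degree v = 2%N.
  move=> xv nv1; have [<-|nxv] := eqVneq x v; first by rewrite edge_sym.
  have [|vz dv] := far v xv nxv; last by rewrite edge_sym.
  by rewrite edge_sym Ny negb_or nv1 eq_sym nxv.
have x1N v : even_conn y v -> v != z -> edge x1 v /\ degree v = 2%N.
  move=> yv nvz; have [<-|nyv] := eqVneq y v; first by rewrite edge_sym.
  have [|vz dv] := far' v yv nyv; last by rewrite edge_sym.
  by rewrite edge_sym Nx negb_or nvz eq_sym nyv.
have zx : edge z x by rewrite edge_sym.
have x1y : edge x1 y by rewrite edge_sym.
have nboth v : even_conn x v -> even_conn y v -> False.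
  by move=> xv yv; apply: (negP nexy); apply: connect_trans xv _; rewrite [connect _ _ _]even_conn_sym.
right; exists z, x1; split=> //; first by exists x.
  move=> v nvz nv1; case/orP: (even_conn_total v G_conn xy) => [xv|yv].
    have [zv dv] := zN v xv nv1; split=> //; rewrite zv; apply/esym/negP => x1v.
    by apply: (nboth _ xv); apply: even_conn_nbrs x1y x1v.
  have [x1v dv] := x1N v yv nvz; split=> //; rewrite x1v; apply/negP => zv.
  by apply: (fun xv => nboth v xv yv); apply: even_conn_nbrs zx zv.
split=> v w hv vw nw.
  have yw : even_conn y w by rewrite -(even_conn_edge xy vw); apply: even_conn_nbrs zx hv.
  by have [] := x1N w yw nw.
have xw : even_conn x w by rewrite -(even_conn_edge yx vw); apply: even_conn_nbrs x1y hv.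
by have [] := zN w xw nw.
Qed.

(** At [x] of minimal degree [d], the law gives [d / 4 + c d^2 <= 1], so [d < 4]. The mean of
    [1 / d_z] over its neighbours is [1/4 + c d], so some neighbour [y] has degree at most 3. The
    few remaining pairs of degrees are treated one by one. *)
Lemma codeg_law_shape (x0 : G) :
  [\/ forall x : G, degree x = 1%N, windmill_like G | theta_like G].
Proof.
have shape2 x y : edge x y -> degree x = 2%N -> degree y = 2%N ->
    [\/ forall x : G, degree x = 1%N, windmill_like G | theta_like G].
  by move=> xy dx dy; case: (adjacent_degree2 xy dx dy); [constructor 2 | constructor 3].
have [x _ x_min] := @arg_minnP G x0 predT (@degree G) isT.
have le_inv v : (deg v)^-1 <= (deg x)^-1.
  by rewrite lef_pV2 ?posrE ?deg_gt0 // ler_nat x_min.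
have Sx := sum_invdeg x.
have degree_lt n v : n%:R^-1 < (deg v)^-1 -> (0 < n)%N -> (degree v < n)%N.
  by move=> ltv n0; move: ltv; rewrite ltf_pV2 ?posrE ?ltr0n // ltr_nat.
have dx4 : (degree x < 4)%N.
  have : \sum_(z | edge x z) (deg z)^-1 <= 1.
    rewrite -[X in _ <= X](mulfV (deg_neq0 x)) -sum_nbrs_const.
    by apply: ler_sum => z _; exact: le_inv.
  rewrite Sx -(ltr_nat F) -/(deg x) => S1.
  by have := mulr_gt0 c_gt0 (exprn_gt0 2 (deg_gt0 x)); deg_lra.
have big_inv n : degree x = n.+1 -> exists2 y, edge x y & 4^-1 < (deg y)^-1.
  move=> dx; have /exists_inP[y xy uy] : [exists (y | edge x y), 4^-1 < (deg y)^-1].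
    apply: contraT; rewrite negb_exists_in => /forall_inP small.
    have : \sum_(z | edge x z) (deg z)^-1 <= deg x * 4^-1.
      by rewrite -sum_nbrs_const; apply: ler_sum => z xz; rewrite leNgt small.
    rewrite Sx => S1.
    by have := mulr_gt0 c_gt0 (exprn_gt0 2 (deg_gt0 x)); deg_lra.
  by exists y.
have [dx|dx|dx] : [\/ degree x = 1%N, degree x = 2%N | degree x = 3%N].
  by move: (degree_gt0 x) dx4; case: (degree x) => [|[|[|[|]]]] // _ _;
    [constructor 1 | constructor 2 | constructor 3].
- have [y xy uy4] := big_inv _ dx; have Nx := nbrs1 dx xy.
  have yx : edge y x by rewrite edge_sym.
  have Dx : deg x = 1 := degE dx; rewrite (sum_nbrs1 _ Nx) Dx in Sx.
  have : (degree y < 4)%N by apply: degree_lt.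
  have near v : edge y v -> v != x -> (deg y)^-1 = c * deg v.
    move=> yv; rewrite eq_sym => nxv; rewrite -[c]mulr1 -Dx -codeg_neq ?(even_conn_nbrs yx yv) //.
    by rewrite codeg_sum (sum_nbrs1 _ Nx) edge_sym yv.
  case dy: (degree y) (degree_gt0 y) => [|[|[|[|]]]] // _ _.
  + have Ny := nbrs1 dy yx; constructor 1 => v.
    case/orP: (even_conn_total v G_conn xy) => [xv|yv].
      have [<-//|nxv] := eqVneq x v; have [z] := common_nbr xv nxv.
      by rewrite Nx => /eqP->; rewrite edge_sym Ny => /eqP vx; rewrite vx eqxx in nxv.
    have [<-//|nyv] := eqVneq y v; have [z] := common_nbr yv nyv.
    by rewrite Ny => /eqP->; rewrite edge_sym Nx => /eqP vy; rewrite vy eqxx in nyv.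
  + have [x' nx' Ny] := nbrs2 dy yx; have yx' : edge y x' by rewrite Ny eqxx orbT.
    (* Here [1/2 = 1/4 + c] gives [c = 1/4], and [1/2 = c d_x'] gives [d_x' = 2]. *)
    apply: (shape2 _ _ yx' dy); apply: deg_inj; apply: (mulfI c_neq0).
    by rewrite -near // (degE dy); rewrite (degE dy) in Sx; deg_lra.
  have c12 : c = 12^-1 by rewrite (degE dy) in Sx; deg_lra.
  have [x' yx' nx'] : exists2 x', edge y x' & x' != x.
    have : (0 < #|[set z | edge y z && (z != x)]|)%N by move: dy; rewrite (degree_rem yx) => -[->].
    by case/card_gt0P => x'; rewrite inE => /andP[]; exists x'.
  have Dx' : deg x' = 4 by have := near x' yx' nx'; rewrite c12 (degE dy); deg_lra.
  (* A leaf [z] at [x'] would give [1/4 = 1/4 + c], so all neighbours of [x'] have degree at least 2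
     and the sum is at most 2; the law makes it [7/3]. *)
  have : \sum_(z | edge x' z) (deg z)^-1 <= deg x' * 2^-1.
    rewrite -sum_nbrs_const; apply: ler_sum => z x'z.
    have := degree_gt0 z; rewrite leq_eqVlt => /predU1P[/esym dz|dz].
      have zx' : edge z x' by rewrite edge_sym.
      by have := sum_invdeg z; rewrite (sum_nbrs1 _ (nbrs1 dz zx')) (degE dz) Dx' c12; deg_lra.
    by rewrite lef_pV2 ?posrE ?deg_gt0 // ler_nat.
  by rewrite sum_invdeg Dx' c12; deg_lra.
- have [y xy uy4] := big_inv _ dx; have Dx := degE dx.
  have yx : edge y x by rewrite edge_sym.
  have : (degree y < 4)%N by apply: degree_lt.
  have := x_min y isT; rewrite dx; case dy: (degree y) => [|[|[|[|]]]] // _ _.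
    exact: shape2 xy dx dy.
  have Dy := degE dy; have [z nzy Nx] := nbrs2 dx xy.
  rewrite (sum_nbrs2 _ nzy Nx) Dy Dx in Sx.
  have xz : edge x z by rewrite Nx eqxx orbT.
  have := x_min z isT; rewrite dx leq_eqVlt => /predU1P[/esym dz|dz].
    exact: shape2 xz dx dz.
  have uz : (deg z)^-1 <= 3^-1 by rewrite lef_pV2 ?posrE ?deg_gt0 // ler_nat.
  have uv v : edge y v -> v != x -> (deg v)^-1 <= 6 * c.
    move=> yv; rewrite eq_sym => /(invdeg_le yx yv); rewrite Dx Dy => h.
    by rewrite -div1r ler_pdivrMr ?deg_gt0 //; deg_lra.
  (* At [y], [3/4 + 9 c <= 1/2 + 12 c] gives [c >= 1/12], while [Sx] and [uz] give [c <= 1/24]. *)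
  have := sum_nbrs_le yx uv; rewrite sum_invdeg Dx Dy => h; deg_lra.
have [y xy uy4] := big_inv _ dx; have Dx := degE dx.
have yx : edge y x by rewrite edge_sym.
have dy : degree y = 3%N.
  by apply/eqP; rewrite eqn_leq -{2}dx x_min // andbT -ltnS degree_lt.
have Dy := degE dy.
have uv v : edge y v -> v != x -> (deg v)^-1 <= 9 * c.
  move=> yv; rewrite eq_sym => /(invdeg_le yx yv); rewrite Dx Dy => h.
  by rewrite -div1r ler_pdivrMr ?deg_gt0 //; deg_lra.
(* At [y], [3/4 + 9 c <= 1/3 + 18 c] gives [9 c >= 5/12]; the sum at [x] is at most 1, which gives
   [9 c <= 1/4]. *)
have := sum_nbrs_le yx uv; rewrite sum_invdeg Dx Dy => h.
have : \sum_(z | edge x z) (deg z)^-1 <= deg x * 3^-1.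
  by rewrite -sum_nbrs_const; apply: ler_sum => z _; have := le_inv z; rewrite Dx.
rewrite Sx Dx; deg_lra.
Qed.

End Classification.

(** * Explicit labellings by windmills and theta graphs *)

Section Isomorphisms.

Lemma isomorphic_inv (G H : sgraph) (g : H -> G) :
    injective g -> (forall v, exists x, g x = v) ->
    (forall x y, edge (g x) (g y) = edge x y) ->
  isomorphic G H.
Proof.
move=> g_inj g_surj gE.
have g_surj' v : exists x, g x == v by have [x <-] := g_surj v; exists x.
pose f v := xchoose (g_surj' v).
have gK v : g (f v) = v by apply/eqP; exact: (xchooseP (g_surj' v)).
exists f; last by move=> x y; rewrite -gE !gK.
by exists g => [//|x]; apply: g_inj; rewrite gK.
Qed.

Variable G : sgraph.
Implicit Types (x y z v w : G).

(** Off the hub, [s] sends a vertex to its other neighbour and is an involution without fixed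
    points. [T] takes from each pair the vertex of smaller rank, and thus indexes the triangles. *)
Lemma windmill_like_iso :
  windmill_like G -> exists2 t : nat, (1 <= t)%N & isomorphic G (windmill t).
Proof.
move=> [z [v0 zv0] zN].
(* The default [v] is never taken off the hub, where the search succeeds. *)
pose s v := odflt v [pick w | edge v w && (w != z)].
have sP v : v != z -> s v != z /\ forall w, edge v w = (w == z) || (w == s v).
  move=> /zN[zv dv]; rewrite edge_sym in zv.
  have [a naz Nv] := nbrs2 dv zv; rewrite /s; case: pickP => [w /andP[]|/(_ a)] /=.
    by rewrite Nv => /predU1P[->|/eqP->]; rewrite ?eqxx.
  by rewrite Nv eqxx orbT naz.
have sz v (vz : v != z) : s v != z by case: (sP v vz).
have sE v w : v != z -> w != z -> edge v w = (w == s v).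
  by move=> vz /negbTE wz; have [_ ->] := sP v vz; rewrite wz.
have sK v : v != z -> s (s v) = v.
  by move=> vz; apply/esym/eqP; rewrite -sE ?sz // edge_sym sE ?sz.
have sv v : v != z -> s v != v.
  by move=> vz; have := sE v v vz vz; rewrite edge_irrefl eq_sym => <-.
pose T := [set v | (v != z) && (enum_rank v < enum_rank (s v))%N].
have T_or v : v != z -> (v \in T) || (s v \in T).
  move=> vz; rewrite !inE vz sz //= sK // -neq_ltn.
  by rewrite (inj_eq val_inj) (inj_eq enum_rank_inj) eq_sym sv.
pose e (i : 'I_#|T|) : G := enum_val i.
have eT i : (e i != z) && (enum_rank (e i) < enum_rank (s (e i)))%N.
  by have := enum_valP i; rewrite inE.
have ez i : e i != z by case/andP: (eT i).
pose g (o : option ('I_#|T| * bool)) : G :=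
  if o is Some (i, b) then (if b then s (e i) else e i) else z.
have gz i b : g (Some (i, b)) != z by case: b; rewrite /g ?sz ?ez.
have sg i b : s (g (Some (i, b))) = g (Some (i, ~~ b)) by case: b; rewrite /g ?sK.
have e_ns i j : e i <> s (e j).
  move=> Ei; have /andP[_] := eT j; have /andP[_] := eT i.
  by rewrite -Ei {2}Ei sK // => /ltn_trans h /h; rewrite ltnn.
have g_inj : injective g.
  have ie i j : e i = e j -> i = j by exact: enum_val_inj.
  move=> [[i a]|] [[j b]|] // E; last 2 first.
  - by have := gz i a; rewrite E eqxx.
  - by have := gz j b; rewrite -E eqxx.
  case: a b E => -[] /= E.
  - by rewrite (ie i j) // -[LHS]sK // E sK.
  - by case: (e_ns j i).
  - by case: (e_ns i j).
  - by rewrite (ie i j).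
exists #|T|.
  have v0z : v0 != z by rewrite eq_sym edge_neq.
  by case/orP: (T_or v0 v0z) => vT; apply/card_gt0P; [exists v0 | exists (s v0)].
apply: (@isomorphic_inv _ (windmill #|T|) g) => // [v|].
  have [->|vz] := eqVneq v z; first by exists None.
  case/orP: (T_or v vz) => vT.
    by exists (Some (enum_rank_in vT v, false)); rewrite /= /e enum_rankK_in.
  by exists (Some (enum_rank_in vT (s v), true)); rewrite /= /e enum_rankK_in // sK.
move=> [[i a]|] [[j b]|].
- rewrite sE ?gz // sg (inj_eq g_inj) /= (inj_eq Some_inj) xpair_eqE eq_sym.
  by congr (_ && _); case: a; case: b.
- by rewrite edge_sym; case: (zN _ (gz i a)).
- by case: (zN _ (gz j b)).
- exact: edge_irrefl.
Qed.

(** Again [s] exchanges the two vertices of each path; the representative in [T] is now the one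
    adjacent to [p]. *)
Lemma theta_like_iso :
  theta_like G -> exists2 t : nat, (1 <= t)%N & isomorphic G (theta2 t).
Proof.
move=> [p [q [npq Npq [v0 pv0] NN [Np Nq]]]].
pose hub v := (v == p) || (v == q).
pose s v := odflt v [pick w | edge v w && ~~ hub w].
have hubN v : ~~ hub v -> degree v = 2%N /\ edge p v = ~~ edge q v.
  by rewrite negb_or => /andP[? ?]; apply: NN.
have pN v : edge p v -> ~~ hub v.
  move=> pv; rewrite negb_or eq_sym edge_neq //=.
  by apply: contraNneq Npq => <-.
have qN v : edge q v -> ~~ hub v.
  move=> qv; rewrite negb_or andbC eq_sym edge_neq //=.
  by apply: contraNneq Npq => <-; rewrite edge_sym.
have sP v : ~~ hub v -> [/\ ~~ hub (s v), edge q (s v) = edge p v &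
    forall w, edge v w = (w == if edge p v then p else q) || (w == s v)].
  move=> vN; have [dv pqv] := hubN v vN.
  pose h := if edge p v then p else q; rewrite -/h.
  have hv : edge v h.
    by rewrite edge_sym /h; case: ifPn => //; rewrite pqv negbK.
  have [a nah Nv] := nbrs2 dv hv.
  have va : edge v a by rewrite Nv eqxx orbT.
  have [aN qa] : ~~ hub a /\ edge q a = edge p v.
    move: nah; rewrite /h; case: (boolP (edge p v)) => [pv nap|pv naq].
      by have qa := Np v a pv va nap; split; [exact: qN | exact: qa].
    have qv : edge q v by rewrite pqv negbK in pv.
    have pa := Nq v a qv va naq; split; first exact: pN.
    by apply/negbTE; rewrite -(hubN a (pN a pa)).2.
  have -> : s v = a.
    rewrite /s; case: pickP => [w /andP[]|/(_ a)] /=; last by rewrite va aN.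
    rewrite Nv => /predU1P[->|/eqP->] //.
    by rewrite (_ : hub h) // /h /hub; case: ifP; rewrite eqxx ?orbT.
  by split.
have sN v (vN : ~~ hub v) : ~~ hub (s v) by case: (sP v vN).
have sE v w : ~~ hub v -> ~~ hub w -> edge v w = (w == s v).
  move=> vN wN; have [_ _ ->] := sP v vN; rewrite (_ : w == _ = false) //.
  by apply: contraNF wN => /eqP->; rewrite /hub; case: ifP => _; rewrite eqxx ?orbT.
have sK v : ~~ hub v -> s (s v) = v.
  by move=> vN; apply/esym/eqP; rewrite -sE ?sN // edge_sym sE ?sN.
pose T := [set v | edge p v].
pose e (i : 'I_#|T|) : G := enum_val i.
have eT i : edge p (e i) by have := enum_valP i; rewrite inE.
have eN i : ~~ hub (e i) by exact: pN.
pose g (o : bool + 'I_#|T| * bool) : G :=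
  match o with
  | inl c => if c then q else p
  | inr (i, b) => if b then s (e i) else e i
  end.
have gN i b : ~~ hub (g (inr (i, b))) by case: b; rewrite /g ?sN.
have gh c : hub (g (inl c)) by case: c; rewrite /hub /g eqxx ?orbT.
have sg i b : s (g (inr (i, b))) = g (inr (i, ~~ b)) by case: b; rewrite /g ?sK.
have qg i b : edge q (g (inr (i, b))) = b.
  case: b; rewrite /g; first by have [_ -> _] := sP _ (eN i); rewrite eT.
  by apply/negbTE; rewrite -(hubN _ (eN i)).2 eT.
have pg i b : edge p (g (inr (i, b))) = ~~ b by rewrite (hubN _ (gN i b)).2 qg.
have g_inj : injective g.
  move=> [c|[i a]] [d|[j b]] E; last 1 first.
  - have Eab : a = b by rewrite -(qg i a) E qg.
    rewrite -{}Eab in E *; suff -> : i = j by [].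
    apply: enum_val_inj; case: a E => //= E.
    by rewrite -[LHS]sK // -/(e i) E sK.
  - by case: c d E => -[] //= E; rewrite E eqxx in npq.
  - by have := gN j b; rewrite -E gh.
  - by have := gN i a; rewrite E gh.
exists #|T|; first by apply/card_gt0P; exists v0; rewrite inE.
apply: (@isomorphic_inv _ (theta2 #|T|) g) => // [v|].
  case: (boolP (hub v)) => [/orP[]/eqP->|vN].
  - by exists (inl false).
  - by exists (inl true).
  have [pv|pv] := boolP (v \in T).
    by exists (inr (enum_rank_in pv v, false)); rewrite /= /e enum_rankK_in.
  have sT : s v \in T.
    rewrite inE (hubN _ (sN v vN)).2; have [_ -> _] := sP v vN.
    by rewrite inE in pv.
  by exists (inr (enum_rank_in sT (s v), true)); rewrite /= /e enum_rankK_in // sK.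
have hE c i b : edge (g (inl c)) (g (inr (i, b))) = (c == b).
  by case: c; rewrite [g (inl _)]/= ?qg ?pg; case: b.
move=> [c|[i a]] [d|[j b]].
- by case: c; case: d; rewrite /= ?edge_irrefl // ?(edge_sym q) (negbTE Npq).
- exact: hE.
- by rewrite edge_sym hE eq_sym.
- rewrite sE ?gN // sg (inj_eq g_inj) /= (inj_eq inr_inj) xpair_eqE eq_sym.
  by congr (_ && _); case: a; case: b.
Qed.

End Isomorphisms.

(** * Windmills and theta graphs *)

Section Orders.

Variables (F : realFieldType) (G : sgraph).

Lemma walk_orderD m n :
  walk_order F G m -> walk_order F G n -> walk_order F G (m + n).
Proof. by move=> Um Un g x y xy; rewrite iterD Um // Un. Qed.

Lemma walk_orderB m n :
  walk_order F G m -> walk_order F G (m + n) -> walk_order F G n.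
Proof. by move=> Um Umn g x y xy; rewrite -Um // -iterD Umn. Qed.

(** Exponents [k] with [U^k = 1] are closed under sums and differences: 4 would yield 2, 5 would
    yield 1, and 1 would yield 2. *)
Lemma walk_order_min6 k :
    walk_order F G 6 -> ~ walk_order F G 2 -> ~ walk_order F G 3 ->
  (0 < k)%N -> walk_order F G k -> (6 <= k)%N.
Proof.
move=> U6 U2 U3; have U1 : ~ walk_order F G 1 
  by move=> U; apply: U2; exact: (walk_orderD U U).
case: k => [|[|[|[|[|[|k]]]]]] // _ U.
  by case: U2; exact: (@walk_orderB 4 2).
by case: U1; exact: (@walk_orderB 5 1).
Qed.

(** When all degrees are 1 the walk merely reverses arcs. *)
Lemma walk_order2_degree1 : (forall x : G, degree x = 1%N) -> walk_order F G 2.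
Proof.
move=> d1 g; have flip h (x y : G) : edge x y -> walk h x y = h y x :> F.
  move=> xy; rewrite /walk /degr d1 (eq_bigl _ _ (nbrs1 (d1 x) xy)) big_pred1_eq.
  by field.
by move=> x y xy /=; rewrite !flip // edge_sym.
Qed.

End Orders.

Lemma walk_order_iso (F : realFieldType) (G H : sgraph) k :
  isomorphic G H -> walk_order F G k <-> walk_order F H k.
Proof.
move=> [f [f' fK f'K] fE].
have sumE x (h : H -> F) : \sum_(z | edge (f x) z) h z = \sum_(z | edge x z) h (f z).
  by rewrite (reindex f); [apply: eq_bigl => z; rewrite fE | exists f' => ? _].
have degE x : degr F (f x) = degr F x.
  have degS (K : sgraph) (z : K) : degr F z = \sum_(w | edge z w) 1.
    by rewrite sumr_const /degr /degree cardsE.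
  by rewrite !degS sumE.
have iterE g h : (forall x y, g x y = h (f x) (f y)) ->
    forall x y, iter k (@walk F G) g x y = iter k (@walk F H) h (f x) (f y).
  move=> gh; elim: k => //= n IH x y; rewrite /walk degE sumE IH.
  by under eq_bigr do rewrite IH.
split=> U g x y xy.
  rewrite -[x]f'K -[y]f'K -(iterE (fun x y => g (f x) (f y))) // U //.
  by rewrite -fE !f'K.
rewrite (iterE _ (fun x y => g (f' x) (f' y))) => [|? ?]; last by rewrite !fK.
by rewrite U ?fE // !fK.
Qed.

Section Windmill.

Variables (F : realFieldType) (t : nat).
Hypothesis t_gt0 : (0 < t)%N.
Local Notation W := (windmill t).
Implicit Types (f : W -> F) (i : 'I_t) (b : bool).

Local Notation rim i b := (Some (i, b) : W).
Local Notation hub := (None : W).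

Lemma sum_option (T : finType) (P : pred (option T)) (h : option T -> F) :
  \sum_(z | P z) h z = (if P None then h None else 0) + \sum_(z | P (Some z)) h (Some z).
Proof.
rewrite big_mkcond (bigD1 None) //=; congr (_ + _).
rewrite [RHS]big_mkcond /= (reindex_omap Some id) => [|[z|]] //=.
by apply: eq_bigl => z; rewrite eqxx.
Qed.

Lemma windmill_sum_hub f : \sum_(z | edge hub z) f z = \sum_p f (Some p).
Proof. by rewrite sum_option /= add0r. Qed.

Lemma windmill_sum_rim f i b : \sum_(z | edge (rim i b) z) f z = f hub + f (rim i (~~ b)).
Proof.
rewrite sum_option /=; congr (_ + _); apply: big_pred1 => -[j a] /=.
by rewrite xpair_eqE eq_sym; congr (_ && _); case: a; case: b.
Qed.

Lemma windmill_deg_hub : degr F hub = 2 * t%:R.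
Proof.
have -> : degr F hub = \sum_(z | edge hub z) 1 by rewrite sumr_const /degr /degree cardsE.
by rewrite windmill_sum_hub sumr_const card_prod card_ord card_bool natrM mulrC.
Qed.

Lemma windmill_deg_rim i b : degr F (rim i b) = 2.
Proof.
have -> : degr F (rim i b) = \sum_(z | edge (rim i b) z) 1 by rewrite sumr_const /degr /degree cardsE.
by rewrite windmill_sum_rim.
Qed.

Lemma windmill_degree_gt0 (x : W) : (0 < degree x)%N.
Proof.
by apply/card_gt0P; case: x => [[i b]|];
  [exists hub | exists (rim (Ordinal t_gt0) false)]; rewrite inE /=.
Qed.

(** With degrees [2 t] at the hub and 2 on the rim, this is the sum of [d_z f z] over all vertices
    divided by [2 t], as [walk_order6] requires for the relation that always holds. *)
Lemma windmill_lap f x : lap f x = f hub + (\sum_p f (Some p)) / t%:R.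
Proof.
have t0 : t%:R != 0 :> F by rewrite pnatr_eq0 -lt0n.
have avg_rim (h : W -> F) i b : avg h (rim i b) = (h hub + h (rim i (~~ b))) / 2.
  by rewrite /avg windmill_sum_rim windmill_deg_rim mulrC.
have avg_hub (h : W -> F) : avg h hub = (\sum_p h (Some p)) / (2 * t%:R).
  by rewrite /avg windmill_sum_hub windmill_deg_hub mulrC.
rewrite /lap; case: x => [[i b]|].
  by rewrite avg_rim avg_hub avg_rim negbK; field.
rewrite avg_hub.
have -> : \sum_p avg f (Some p : W) = t%:R * f hub + 2^-1 * \sum_p f (Some p).
  transitivity (\sum_(p : 'I_t * bool) (2^-1 * f hub + 2^-1 * f (rim p.1 (~~ p.2)))).
    by apply: eq_bigr => -[i b] _; rewrite avg_rim /=; field.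
  rewrite big_split /= sumr_const -mulr_sumr card_prod card_ord card_bool.
  rewrite [in RHS](reindex (fun p : 'I_t * bool => (p.1, ~~ p.2))) /=; last first.
    by exists (fun p => (p.1, ~~ p.2)) => -[i b] _ /=; rewrite negbK.
  by congr (_ + _); rewrite -[LHS]mulr_natr natrM; field.
by field.
Qed.

Lemma windmill_order6 : walk_order F W 6.
Proof.
have t0 : t%:R != 0 :> F by rewrite pnatr_eq0 -lt0n.
apply: (@walk_order6 _ _ windmill_degree_gt0 (fun _ _ => true) (2 * t%:R)^-1) => // f x.
rewrite windmill_lap (sum_option xpredT) /= windmill_deg_hub.
rewrite [X in _ = _ * (_ + X)](eq_bigr (fun p => 2 * f (Some p))) => [|[i b] _].
  by rewrite -mulr_sumr; field.
by rewrite windmill_deg_rim.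
Qed.

Lemma windmill_not_order2 : ~ walk_order F W 2.
Proof.
move=> U2; pose f (x : W) : F := (x == hub)%:R.
(* At the hub [lap f] is 1 and at the rim the mean of [f] is [1/2], so the left side is 0 while
   [f hub = 1]. *)
have := @walk_square_lift _ _ windmill_degree_gt0 f hub (rim (Ordinal t_gt0) false) U2 isT.
rewrite windmill_lap /avg windmill_sum_rim windmill_deg_rim big1 // /f eqxx /=.
by rewrite mulr0n mulr1n => E; lra.
Qed.

End Windmill.

(** A point mass in a second triangle vanishes at a rim vertex of the first and on its neighbours,
    but [lap f] is [1 / t] everywhere; the cube identity would give [1 / t = 0]. *)
Lemma windmill_not_order3 (F : realFieldType) t :
  (2 <= t)%N -> ~ walk_order F (windmill t) 3.
Proof.
move=> t_gt1 U3; have t_gt0 := ltnW t_gt1.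
pose i0 := Ordinal t_gt0; pose i1 := Ordinal t_gt1.
pose f (x : windmill t) : F := (x == Some (i1, false))%:R.
have dg := windmill_degree_gt0 t_gt0.
have := @walk_cube_lift _ _ dg f (Some (i0, false)) None U3 isT.
rewrite (avg_cst_nbrs dg (f := lap f) (fun z _ => windmill_lap t_gt0 f z)) windmill_lap //.
rewrite (avg_cst_nbrs dg (a := 0)) => [|[[i b]|] //=]; last first.
  by move=> /andP[/eqP<- _].
rewrite (bigD1 (i1, false)) //= big1 => [|p /negbTE np]; last first.
  by rewrite /f (inj_eq Some_inj) np.
have : (t%:R : F)^-1 != 0 by rewrite invr_eq0 pnatr_eq0 -lt0n.
by rewrite /f /= => /eqP t0 E; apply: t0; lra.
Qed.

(** In a triangle all degrees are 2, so the value at [(x, y)] becomes the one at [(z, x)], with [z]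
    the third vertex: a rotation of each oriented triangle. *)
Lemma windmill1_order3 (F : realFieldType) : walk_order F (windmill 1) 3.
Proof.
pose r b : windmill 1 := Some (ord0, b); pose h : windmill 1 := None.
have whr (g : windmill 1 -> windmill 1 -> F) b : walk g h (r b) = g (r (~~ b)) h :> F.
  rewrite /walk windmill_deg_hub windmill_sum_hub.
  rewrite (bigD1 (ord0, b)) //= (big_pred1 (ord0, ~~ b)) => [|[i a]]; first by rewrite /r; field.
  by rewrite (ord1 i) /= !xpair_eqE eqxx; case: a; case: b.
have wrh (g : windmill 1 -> windmill 1 -> F) b : walk g (r b) h = g (r (~~ b)) (r b) :> F.
  by rewrite /walk windmill_deg_rim windmill_sum_rim -/(r b) -/(r (~~ b)) -/h; field.
have wrr (g : windmill 1 -> windmill 1 -> F) b : walk g (r b) (r (~~ b)) = g h (r b) :> F.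
  by rewrite /walk windmill_deg_rim windmill_sum_rim -/(r b) -/(r (~~ b)) -/h; field.
move=> g [[i a]|] [[j b]|] //= => [/andP[_ ab]|_|_].
- rewrite (ord1 i) (ord1 j) -/(r a) -/(r b); have -> : b = ~~ a by case: a b ab => -[].
  by rewrite wrr whr wrh negbK.
- by rewrite (ord1 i) -/(r a) -/h wrh -{2}[a]negbK wrr whr negbK.
- by rewrite (ord1 j) -/(r b) -/h whr wrh negbK wrr.
Qed.

Section Theta.

Variables (F : realFieldType) (t : nat).
Hypothesis t_gt0 : (0 < t)%N.
Local Notation T := (theta2 t).
Implicit Types (f : T -> F) (i : 'I_t) (a b c : bool).

Local Notation pole c := (inl c : T).
Local Notation mid i b := (inr (i, b) : T).

Lemma theta_sum_pole f c : \sum_(z | edge (pole c) z) f z = \sum_i f (mid i c).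
Proof.
rewrite big_sumType /= big_pred0_eq add0r.
rewrite (reindex_omap (fun i => (i, c)) (fun p => if c == p.2 then Some p.1 else None)) /=.
  by apply: eq_bigl => i; rewrite !eqxx.
by move=> [i b] /= /eqP->; rewrite eqxx.
Qed.

Lemma theta_sum_mid f i a : \sum_(z | edge (mid i a) z) f z = f (pole a) + f (mid i (~~ a)).
Proof.
rewrite big_sumType /=; congr (_ + _).
  by apply: big_pred1 => c; rewrite eq_sym.
apply: big_pred1 => -[j b] /=.
by rewrite xpair_eqE eq_sym; congr (_ && _); case: a; case: b.
Qed.

Lemma theta_deg_pole c : degr F (pole c) = t%:R.
Proof.
have -> : degr F (pole c) = \sum_(z | edge (pole c) z) 1 by rewrite sumr_const /degr /degree cardsE.
by rewrite theta_sum_pole sumr_const card_ord.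
Qed.

Lemma theta_deg_mid i a : degr F (mid i a) = 2.
Proof.
have -> : degr F (mid i a) = \sum_(z | edge (mid i a) z) 1 by rewrite sumr_const /degr /degree cardsE.
by rewrite theta_sum_mid.
Qed.

Lemma theta_degree_gt0 (x : T) : (0 < degree x)%N.
Proof.
by apply/card_gt0P; case: x => [c|[i a]]; [exists (mid (Ordinal t_gt0) c) | exists (pole a)];
  rewrite inE /=.
Qed.

(** The proper 2-colouring of this bipartite graph, giving the relation used in [walk_order6]. *)
Definition theta_side (x : T) : bool :=
  match x with inl c => c | inr (_, a) => ~~ a end.

Lemma theta_lap f x :
  lap f x = f (pole (theta_side x)) + 2 * (\sum_i f (mid i (~~ theta_side x))) / t%:R.
Proof.
have t0 : t%:R != 0 :> F by rewrite pnatr_eq0 -lt0n.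
have avg_mid (h : T -> F) i a : avg h (mid i a) = (h (pole a) + h (mid i (~~ a))) / 2.
  by rewrite /avg theta_sum_mid theta_deg_mid mulrC.
have avg_pole (h : T -> F) c : avg h (pole c) = (\sum_i h (mid i c)) / t%:R.
  by rewrite /avg theta_sum_pole theta_deg_pole mulrC.
rewrite /lap; case: x => [c|[i a]] /=.
  rewrite avg_pole.
  have -> : \sum_i avg f (mid i c) = (t%:R * f (pole c) + \sum_i f (mid i (~~ c))) / 2.
    transitivity (\sum_i 2^-1 * (f (pole c) + f (mid i (~~ c)))).
      by apply: eq_bigr => i _; rewrite avg_mid mulrC.
    by rewrite -mulr_sumr big_split /= sumr_const card_ord -[_ *+ t]mulr_natl mulrC.
  by field.
by rewrite avg_mid avg_pole avg_mid !negbK; field.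
Qed.

Lemma theta_side_edge (x y : T) : edge x y -> theta_side y = ~~ theta_side x.
Proof.
case: x y => [c|[i a]] [d|[j b]] //=; first by move/eqP->.
  by move/eqP->; rewrite negbK.
by case/andP=> _; case: a; case: b.
Qed.

Lemma theta_order6 : walk_order F T 6.
Proof.
have t0 : t%:R != 0 :> F by rewrite pnatr_eq0 -lt0n.
apply: (@walk_order6 _ _ theta_degree_gt0
  (fun x z => theta_side x == theta_side z) t%:R^-1) => [x y z w xy zw|f x].
  by rewrite (theta_side_edge xy) (theta_side_edge zw); case: theta_side; case: theta_side.
rewrite theta_lap big_sumType /=; set c := theta_side x.
rewrite (big_pred1 c) => [|d]; last by rewrite eq_sym.
rewrite theta_deg_pole.
rewrite [X in _ = _ * (_ + X)](_ : _ = 2 * \sum_i f (mid i (~~ c))); first by field.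
rewrite mulr_sumr (reindex_omap (fun i => (i, ~~ c))
  (fun p => if c == ~~ p.2 then Some p.1 else None)) /=.
  by apply: eq_big => [i|i _]; rewrite ?negbK ?eqxx ?theta_deg_mid //=.
by move=> [i b] /= /eqP->; rewrite eqxx negbK.
Qed.

(** One point mass refutes both orders: [lap f0] is 1 on the side of its pole and 0 on the other
    side. *)
Let f0 (x : T) : F := (x == pole false)%:R.
Let y0 := mid (Ordinal t_gt0) false.

Lemma theta_not_order2 : ~ walk_order F T 2.
Proof.
move=> U2; have := @walk_square_lift _ _ theta_degree_gt0 f0 (pole false) y0 U2 isT.
rewrite theta_lap /avg theta_sum_mid theta_deg_mid big1 // /f0 eqxx /=.
by rewrite mulr0n mulr1n => E; lra.
Qed.

Lemma theta_not_order3 : ~ walk_order F T 3.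
Proof.
move=> U3; have := @walk_cube_lift _ _ theta_degree_gt0 f0 (pole false) y0 U3 isT.
rewrite (lap_mean theta_degree_gt0 _ theta_order6 (isT : edge (pole false) y0)).
rewrite theta_lap /= big1 // /avg theta_sum_pole big1 // /f0 eqxx /= mulr0n mulr1n => E.
lra.
Qed.

End Theta.

(** * Equivalence of 6-periodicity with membership in the two families *)

Lemma connected_degree_gt0 (G : sgraph) (x y : G) :
  connected G -> edge x y -> forall v : G, (0 < degree v)%N.
Proof.
move=> G_conn xy v; have [[|w p] /=] := connectP (G_conn v x).
  by move=> _ <-; apply/card_gt0P; exists y; rewrite inE.
by move=> /andP[vw _] _; apply/card_gt0P; exists w; rewrite inE.
Qed.

Local Close Scope ring_scope.

Theorem theorem1p2 (R : realType) (G : sgraph) (G_connected : connected G) :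
  periodic R 6 G <->
  (exists2 t : nat, 2 <= t & isomorphic G (windmill t)) \/
  (exists2 t : nat, 1 <= t & isomorphic G (theta2 t)).
Proof.
split=> [[_ /grover_order U6 Umin]|].
  have order_ge6 k : (0 < k)%N -> walk_order R G k -> (6 <= k)%N.
    by move=> k0 /grover_order; apply: Umin.
  (* Without edges there are no arcs and [U = 1] holds trivially, so the period would be 1. *)
  have [x [y xy]] : exists x y : G, edge x y.
    have [/existsP[x /existsP[y xy]]|/existsPn N] := boolP [exists x : G, [exists y, edge x y]].
      by exists x, y.
    suff /order_ge6-/(_ isT) : walk_order R G 1 by [].
    by move=> g x y xy; case/existsP: (N x); exists y.
  have dg := connected_degree_gt0 G_connected xy.
  have [c c0 cE] := codeg_law_ex dg G_connected x U6.
  (* Minimality of 6 excludes the graphs with all degrees 1, where [U^2 = 1], and the single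
     triangle, where [U^3 = 1]. *)
  case: (codeg_law_shape dg G_connected c0 cE x) => [d1||].
  - by have := order_ge6 2 isT (walk_order2_degree1 d1).
  - case/windmill_like_iso => -[|[|t]] // _ Gt; last by left; exists t.+2.
    by have := order_ge6 3 isT ((walk_order_iso R 3 Gt).2 (@windmill1_order3 R)).
  - by case/theta_like_iso => t t0 Gt; right; exists t.
have periodic_iso H : isomorphic G H ->
    walk_order R H 6 -> ~ walk_order R H 2 -> ~ walk_order R H 3 -> periodic R 6 G.
  move=> GH U6 U2 U3; split=> [//||k k0 /grover_order Uk].
    by apply/grover_order; apply/(walk_order_iso R 6 GH).
  by apply: (walk_order_min6 U6 U2 U3 k0); apply/(walk_order_iso R k GH).
case=> -[t t_gt Gt]; apply: (periodic_iso _ Gt).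
- exact: windmill_order6 (ltnW t_gt).
- exact: windmill_not_order2 (ltnW t_gt).
- exact: windmill_not_order3.
- exact: theta_order6.
- exact: theta_not_order2.
- exact: theta_not_order3.
Qed.
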